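(* Let $(\mathbb{S},\Sigma)$ be a measurable space, let $\{\mu^{(n)}\}_{n=1,2,\ldots}\subset\mathcal{M}(\mathbb{S})$ converge in total variation to a measure $\mu$ on $\mathbb{S}$, let $f\in L^1(\mathbb{S};\mu)$, and let $f^{(n)}\in L^1(\mathbb{S};\mu^{(n)})$ for each $n=1,2,\ldots$. Then the inequality $$\liminf_{n\to\infty}\ \inf_{S\in\Sigma}\left(\int_S f^{(n)}(s)\,\mu^{(n)}(ds)-\int_S f(s)\,\mu(ds)\right)\ge 0$$ holds if and only if the following two statements hold: (i) for each $\varepsilon>0$, $$\mu(\{s\in\mathbb{S}: f^{(n)}(s)\le f(s)-\varepsilon\})\to 0\quad\text{as } n\to\infty,$$ and, therefore, there exists a subsequence $\{f^{(n_k)}\}_{k=1,2,\ldots}$ of $\{f^{(n)}\}_{n=1,2,\ldots}$ such that $\liminf_{k\to\infty} f^{(n_k)}(s)\ge f(s)$ for $\mu$-a.e. $s\in\mathbb{S}$; (ii) the inequality $$\liminf_{K\to+\infty}\ \inf_{n=1,2,\ldots}\int_{\{s\in\mathbb{S}:\, f^{(n)}(s)\le -K\}} f^{(n)}(s)\,\mu^{(n)}(ds)\ge 0$$ holds. (In (i), the assertion about the subsequence is a consequence of the convergence for each $\varepsilon>0$.)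
   Context: $\mathcal{M}(\mathbb{S})$ is the family of finite (nonnegative) measures on $(\mathbb{S},\Sigma)$. Functions $f:\mathbb{S}\to\overline{\mathbb{R}}:=\mathbb{R}\cup\{\pm\infty\}$ are called measurable if $\{s\in\mathbb{S}: f(s)<\alpha\}\in\Sigma$ for each $\alpha\in\mathbb{R}$. For a finite measure $\nu$, $L^1(\mathbb{S};\nu)$ is the set of all measurable functions $g:\mathbb{S}\to\overline{\mathbb{R}}$ with $\int_{\mathbb{S}}|g(s)|\,\nu(ds)<+\infty$ (functions, not equivalence classes). For $\mu\in\mathcal{M}(\mathbb{S})$ and a measure $\nu$ on $\mathbb{S}$, $\mathrm{dist}(\mu,\nu):=\sup\{|\int_{\mathbb{S}} g\,d\mu-\int_{\mathbb{S}} g\,d\nu| : g:\mathbb{S}\to[-1,1]\text{ measurable}\}$; finite measures $\mu^{(n)}$ converge in total variation to a measure $\mu$ if $\lim_{n\to\infty}\mathrm{dist}(\mu^{(n)},\mu)=0$ (then $\mu$ is automatically finite). *)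

(* Defs.v *)
From HB Require Import structures.
From mathcomp Require Export all_boot all_order all_algebra.
From mathcomp Require Export all_classical all_reals all_analysis.

Set Implicit Arguments.
Unset Strict Implicit.
Unset Printing Implicit Defensive.
Export Order.TTheory GRing.Theory Num.Theory.
Export numFieldNormedType.Exports.

Local Open Scope classical_set_scope.
Local Open Scope ring_scope.
Local Open Scope ereal_scope.

(* If one of the measures is infinite, the test function g = 1 makes the
   supremum +oo when the other one is finite, so that convergence of finite
   measures to nu in total variation forces nu to be finite. *)
Definition tv_dist (d : measure_display) (T : measurableType d) (R : realType)
    (mu nu : {measure set T -> \bar R}) : \bar R :=
  ereal_sup [set `| \int[mu]_x (g x)%:E - \int[nu]_x (g x)%:E | |
    g in [set g : T -> R | measurable_fun setT g /\
                           forall x, (-1 <= g x <= 1)%R]].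

Definition cvg_in_tv (d : measure_display) (T : measurableType d)
    (R : realType) (mu_ : nat -> {finite_measure set T -> \bar R})
    (mu : {measure set T -> \bar R}) : Prop :=
  (fun n => tv_dist (mu_ n) mu) @ \oo --> 0.

(* Main.v *)
Require Import Defs.
From mathcomp Require Import measurable_realfun ring lra.

(** The difficulty is that f_ n and f are integrable with respect to different
    measures, and that total variation only controls bounded functions.  The
    bridge is the truncation phi = clip f K of f to [-K, K]: it tends to f in
    L1(mu) as K grows (cvg_clip), and its integrals over all measurable sets
    under mu_ n and mu differ by at most K times the distance of the measures
    (tv_dist_integral_le).

    Necessity.  If the integrals of f_ n under mu_ n are nearly at least those
    of f under mu, uniformly over sets, then for large n they are nearly at
    least those of a fixed phi, all under mu_ n (clip_dominated).
    Comparing on the set where f_ n <= phi - e shows that this set has small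
    measure (dominated_measure_le), which gives the convergence in measure from
    below.  Comparing on S = {f_ n <= - L} with L >= 2 K shows that the tail
    integral of f_ n is small: it is at most - 2 K mu_ n(S), whereas the
    integral of phi is at least - K mu_ n(S) (dominated_tail).

    Sufficiency.  With A the set where f_ n <= f - e, there is a pointwise bound
      f_ n >= f_ n 1_{f_ n <= - K} + phi - e - 2 K 1_A    (clip_lower_bound).
    Integrating it over S under mu_ n, the first term is controlled by the
    uniform tail condition, the second one is close to the integral of f over S
    under mu, and the last one vanishes as n tends to infinity with K fixed.
    None of these errors depends on S.

    The subsequence in the first condition comes from the Borel-Cantelli
    lemma (subseq_le_limn_einf). *)

Set Implicit Arguments.
Unset Strict Implicit.
Unset Printing Implicit Defensive.

Local Open Scope classical_set_scope.
Local Open Scope ring_scope.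
Local Open Scope ereal_scope.

(** * Limits inferior and nonnegative limits in terms of epsilon *)

(** The two liminf conditions of the theorem are turned into statements of
    the form: for every e > 0, eventually everything is at least - e.  This
    group of lemmas does the translation, for any filter, so that it serves
    both for n tending to infinity and for the real threshold K. *)
Lemma limf_einf_ge (R : realType) (T : choiceType) (X : filteredType T)
    (F : set_system X) (u : X -> \bar R) (c : \bar R) :
  (\forall x \near F, c <= u x) -> c <= limf_einf u F.
Proof.
move=> cu; rewrite limf_einfE; apply: le_ereal_sup_tmp.
exists (ereal_inf (u @` [set x | c <= u x])).
  by exists [set x | c <= u x].
by apply: le_ereal_inf_tmp => _ [x cx <-].
Qed.

Lemma limf_einf_ge0P (R : realType) (T : choiceType) (X : filteredType T)
    (F : set_system X) (u : X -> \bar R) : Filter F ->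
  0 <= limf_einf u F <->
  forall e : R, (0 < e)%R -> \forall x \near F, (- e)%:E <= u x.
Proof.
move=> FF; split=> [u0 e e0|h].
  have : (- e)%:E < limf_einf u F.
    by apply: lt_le_trans u0; rewrite lte_fin oppr_lt0.
  rewrite limf_einfE => /ereal_sup_gt[_ [V FV <-]] eV.
  apply: filterS FV => x Vx; apply: (le_trans (ltW eV)).
  by apply: ereal_inf_lbound; exists x.
apply/lee_subgt0Pr => e e0.
by rewrite sub0e -EFinN; apply: limf_einf_ge; exact: h.
Qed.

Lemma ereal_inf_geP (R : realType) (I : Type) (D : set I) (F : I -> \bar R)
    (c : \bar R) :
  c <= ereal_inf [set F i | i in D] <-> forall i, D i -> c <= F i.
Proof.
split=> [h i Di|h]; last by apply: le_ereal_inf_tmp => _ [i Di <-]; exact: h.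
by apply: (le_trans h); apply: ereal_inf_lbound; exists i.
Qed.

Lemma ge0_cvge0P (R : realType) (T : Type) (F : set_system T)
    (u : T -> \bar R) :
  Filter F -> (forall x, 0 <= u x) ->
  u @ F --> 0 <->
  forall e : R, (0 < e)%R -> \forall x \near F, u x <= e%:E.
Proof.
move=> FF u0; split=> [/fine_cvgP[uf /cvgr0Pnorm_le uc] e e0|h].
  apply: filterS2 uf (uc _ e0) => x ufx uxe.
  by rewrite -(fineK ufx) lee_fin; exact: le_trans (ler_norm _) uxe.
have ufin x r : u x <= r%:E -> u x \is a fin_num.
  by move=> ur; rewrite ge0_fin_numE ?u0//; exact: le_lt_trans (ltry r).
apply/fine_cvgP; split; first by apply: filterS (h 1%R ltr01) => x; exact: ufin.
apply/cvgr0Pnorm_le => e e0; apply: filterS (h _ e0) => x uxe.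
by rewrite /= ger0_norm ?fine_ge0// -lee_fin fineK//; exact: ufin uxe.
Qed.

Lemma limf_einf_inf_ge0P (R : realType) (T : choiceType) (X : filteredType T)
    (F : set_system X) (I : Type) (D : set I) (u : I -> X -> \bar R) :
  Filter F ->
  0 <= limf_einf (fun x => ereal_inf [set u i x | i in D]) F <->
  forall e : R, (0 < e)%R ->
    \forall x \near F, forall i, D i -> (- e)%:E <= u i x.
Proof.
by move=> FF; rewrite limf_einf_ge0P; split=> h e /h;
  apply: filterS => x /ereal_inf_geP.
Qed.

(** Each single integrable function has a small lower tail, so a threshold
    that works for all large n can be improved to one that works for all n. *)
Lemma near_forall_ltn (T : Type) (F : set_system T) (P : T -> nat -> Prop) N :
  Filter F -> (forall n, \forall x \near F, P x n) ->
  \forall x \near F, forall n, (n < N)%N -> P x n.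
Proof.
move=> FF FP; elim: N => [|N IH]; first exact: nearW.
apply: filterS2 IH (FP N) => x lt_N PN n.
by rewrite ltnS leq_eqVlt => /predU1P[->//|]; exact: lt_N.
Qed.

(** * Integration against two finite measures *)

Section integrals.
Context (R : realType) (d : measure_display) (T : measurableType d).
Implicit Types (mu nu : {measure set T -> \bar R}) (f g : T -> \bar R)
  (phi : T -> R) (S : set T) (K c e : R).

Lemma integrable_EFinP mu (D : set T) (f : T -> \bar R) :
  measurable D -> mu.-integrable D f ->
  exists r : R, \int[mu]_(x in D) f x = r%:E.
Proof.
move=> mD /(integrable_fin_num mD) ff; exists (fine (\int[mu]_(x in D) f x)).
by rewrite fineK.
Qed.

Lemma bounded_integrable mu (D : set T) (g : T -> R) (K : R) :
  mu setT < +oo -> measurable D -> measurable_fun setT g ->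
  (forall x, `|g x| <= K)%R -> mu.-integrable D (EFin \o g).
Proof.
move=> muoo mD mg gK; apply: (@integrableS _ _ _ _ setT) => //.
apply: measurable_bounded_integrable => //.
exists K; split; first exact: num_real.
by move=> M KM x _ /=; exact: le_trans (ltW KM).
Qed.

Lemma integrable_cst_fin mu (D : set T) (r : R) :
  mu setT < +oo -> measurable D -> mu.-integrable D (cst r%:E).
Proof.
move=> muoo mD.
have mr : measurable_fun setT (cst r : T -> R) by exact: measurable_cst.
exact: (@bounded_integrable _ _ (cst r) `|r|%R).
Qed.

(** The supremum defining the total variation distance is over functions with
    values in [-1, 1] integrated over the whole space; extending g by 0 outside
    S and dividing by K reduces a bounded g on a set S to this case. *)
Lemma tv_dist_integral_le mu nu (e K : R) (S : set T) (g : T -> R) :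
  mu setT < +oo -> nu setT < +oo -> tv_dist mu nu <= e%:E -> (0 < K)%R ->
  measurable S -> measurable_fun setT g -> (forall x, `|g x| <= K)%R ->
  `| \int[mu]_(x in S) (g x)%:E - \int[nu]_(x in S) (g x)%:E | <= (K * e)%:E.
Proof.
move=> muoo nuoo de K0 mS mg gK.
pose h x := (K^-1 * (g \_ S) x)%R.
have mh : measurable_fun setT h.
  apply: measurable_funM => //; apply/measurable_restrict => //.
  by rewrite setTI; exact: measurable_funS mg.
have h1 x : (-1 <= h x <= 1)%R.
  rewrite -ler_norml /h normrM gtr0_norm ?invr_gt0// ler_pdivrMl// mulr1 patchE.
  by case: ifPn => // _; rewrite normr0 ltW.
have I (m : {measure set T -> \bar R}) : m setT < +oo ->
    \int[m]_(x in S) (g x)%:E = K%:E * \int[m]_x (h x)%:E.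
  move=> moo; rewrite -(@integralZl _ _ _ m setT _ (EFin \o h))//; last first.
    by apply: (bounded_integrable (K := 1%R)) => // x; rewrite ler_norml h1.
  rewrite integral_mkcond; apply: eq_integral => x _.
  rewrite -EFinM /h mulrA mulfV ?gt_eqF// mul1r !patchE.
  by case: ifPn.
have [a Ea] : exists r : R, \int[mu]_x (h x)%:E = r%:E.
  apply: integrable_EFinP => //; apply: (bounded_integrable (K := 1%R)) => // x.
  by rewrite ler_norml h1.
have [b Eb] : exists r : R, \int[nu]_x (h x)%:E = r%:E.
  apply: integrable_EFinP => //; apply: (bounded_integrable (K := 1%R)) => // x.
  by rewrite ler_norml h1.
have : `|a%:E - b%:E| <= e%:E.
  by apply: le_trans de; apply: ereal_sup_ubound; exists h => //; rewrite Ea Eb.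
rewrite !I// Ea Eb -!EFinM -!EFinB !abse_EFin !lee_fin.
rewrite -mulrBr normrM (gtr0_norm K0).
by rewrite ler_pM2l.
Qed.

(** The constant test function 1 compares the total masses, and a finite
    number is at distance +oo from +oo. *)
Lemma tv_dist_fin mu nu (e : R) :
  mu setT < +oo -> tv_dist mu nu <= e%:E -> nu setT < +oo.
Proof.
move=> muoo de; rewrite ltey; apply/negP => /eqP nuoo.
have : `| \int[mu]_x (cst 1%R x)%:E - \int[nu]_x (cst 1%R x)%:E | <= e%:E.
  apply: le_trans de; apply: ereal_sup_ubound; exists (cst 1%R) => //.
  by split=> // x /=; apply/andP; split; lra.
rewrite /= !(@integral_cst _ _ _ _ setT _ 1)// !mul1e nuoo.
move: muoo (measure_ge0 mu setT); case: (mu setT) => //.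
Qed.

(** Truncation of f to [-K, K].  It is real valued, hence can be integrated
    against any finite measure, whereas f is only known to be integrable
    with respect to the limit measure. *)
Definition clip (f : T -> \bar R) (K : R) (x : T) : R :=
  fine (maxe (- K)%:E (mine K%:E (f x))).

Lemma clipE f K x : (0 <= K)%R ->
  (clip f K x)%:E = maxe (- K)%:E (mine K%:E (f x)).
Proof.
move=> K0; rewrite /clip fineK//; case: (f x) => [r||].
- by rewrite -EFin_min -EFin_max.
- by rewrite miney -EFin_max.
- by rewrite mineNy maxeNy.
Qed.

Lemma clip_bound f K x : (0 <= K)%R -> (`|clip f K x| <= K)%R.
Proof.
move=> K0; rewrite ler_norml -!lee_fin clipE// le_max lexx/= ge_max ge_min lexx.
by rewrite andbT lee_fin; lra.
Qed.

Lemma measurable_clip f K :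
  measurable_fun setT f -> measurable_fun setT (clip f K).
Proof.
move=> mf; apply: measurableT_comp => //.
by apply: measurable_maxe => //; exact: measurable_mine.
Qed.

Lemma abse_sub_clip_le f K x : (0 <= K)%R -> `|f x - (clip f K x)%:E| <= `|f x|.
Proof.
move=> K0; rewrite clipE//; case: (f x) => [r||]; rewrite ?leey//=.
rewrite -EFin_min -EFin_max -EFinB !abse_EFin lee_fin.
rewrite /Num.min; case: ltP => rK; rewrite /Num.max; case: ltP => Kr;
  by rewrite ler_norml; case: (ger0P r) => r0; apply/andP; split; lra.
Qed.

(** Dominated convergence: where f is finite its truncations are eventually
    equal to it, and the truncation error is bounded by |f|. *)
Lemma cvg_clip mu f : mu.-integrable setT f ->
  (fun n => \int[mu]_x `|f x - (clip f n%:R x)%:E|) @ \oo --> 0.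
Proof.
move=> fi; have mf := measurable_int mu fi.
have := @dominated_convergence _ _ _ mu setT measurableT
  (fun n x => f x - (clip f n%:R x)%:E) (cst 0) (abse \o f).
case=> //.
- move=> n; apply: emeasurable_funB => //; apply/measurable_EFinP.
  exact: measurable_clip.
- apply: filterS (integrable_ae measurableT fi) => x /(_ I) fx _.
  apply: cvg_near_cst; near=> n.
  rewrite clipE//.
  have : (`|fine (f x)| <= n%:R)%R by near: n; exact: nbhs_infty_ger.
  rewrite -(fineK fx) -EFin_min -EFin_max /= ler_norml => /andP[h1 h2].
  by rewrite min_r// max_r// subee.
- exact: integrable_abse.
- by apply: aeW => x n _ /=; exact: abse_sub_clip_le.
move=> _ + _; under eq_fun do under eq_integral do rewrite sube0.
exact.
Unshelve. all: by end_near. Qed.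

Lemma measure_EFinP mu S : mu setT < +oo -> measurable S ->
  exists2 r : R, mu S = r%:E & (0 <= r)%R.
Proof.
move=> muoo mS; have Sfin : mu S \is a fin_num.
  rewrite ge0_fin_numE//; apply: le_lt_trans muoo.
  by apply: le_measure; rewrite ?inE.
by exists (fine (mu S)); rewrite ?fineK// fine_ge0.
Qed.

Lemma tv_dist_measure_le mu nu e S :
  mu setT < +oo -> nu setT < +oo -> tv_dist mu nu <= e%:E -> measurable S ->
  mu S <= nu S + e%:E /\ nu S <= mu S + e%:E.
Proof.
move=> muoo nuoo tv mS.
have c1 (x : T) : (`|cst 1%R x : R| <= 1)%R by rewrite normr1.
have m1 : measurable_fun setT (cst 1%R : T -> R) by exact: measurable_cst.
have := tv_dist_integral_le muoo nuoo tv ltr01 mS m1 c1.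
rewrite /= !(@integral_cst _ _ _ _ _ _ 1)// !mul1e mul1r.
have [a -> _] := measure_EFinP muoo mS.
have [b -> _] := measure_EFinP nuoo mS.
rewrite -EFinB abse_EFin -!EFinD !lee_fin ler_norml => /andP[? ?].
by split; lra.
Qed.

Lemma measurable_le_cst f (r : R) : measurable_fun setT f ->
  measurable [set x | f x <= r%:E].
Proof.
move=> mf; rewrite -[X in measurable X]setTI.
exact: emeasurable_fun_infty_c.
Qed.

Lemma measurable_le_fun f g : measurable_fun setT f -> measurable_fun setT g ->
  measurable [set x | f x <= g x].
Proof.
by move=> mf mg; rewrite -[X in measurable X]setTI; exact: measurable_lee.
Qed.

(** An L1 error on the whole space bounds the error on all measurable sets
    at once. *)
Lemma abse_integral_sub_le mu S f g :
  measurable S -> mu.-integrable setT f -> mu.-integrable setT g ->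
  `| \int[mu]_(x in S) f x - \int[mu]_(x in S) g x | <=
  \int[mu]_x `|f x - g x|.
Proof.
move=> mS fi gi.
have fiS : mu.-integrable S f by apply: (integrableS measurableT).
have giS : mu.-integrable S g by apply: (integrableS measurableT).
have fgi := integrableB measurableT fi gi.
rewrite -integralB//; apply: (le_trans (le_abse_integral _ _ _)) => //.
  by apply: (measurable_int mu); exact: integrableB.
apply: ge0_subset_integral => //.
by apply: measurableT_comp => //; exact: (measurable_int _ fgi).
Qed.

(** Passing from f under mu to a truncation under nu costs the truncation error
    (at most c) and K times the total variation distance (at most c);
    the lower bound on the gap gives the third c. *)
Lemma integral_clip_le_near mu nu f g K c e S :
  mu setT < +oo -> nu setT < +oo -> tv_dist nu mu <= e%:E ->
  (0 < K)%R -> (K * e <= c)%R ->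
  mu.-integrable setT f -> nu.-integrable setT g ->
  \int[mu]_x `|f x - (clip f K x)%:E| <= c%:E -> measurable S ->
  (- c)%:E <= \int[nu]_(x in S) g x - \int[mu]_(x in S) f x ->
  \int[nu]_(x in S) (clip f K x)%:E <= \int[nu]_(x in S) g x + (3 * c)%:E.
Proof.
move=> muoo nuoo tv K0 Ke fi gi fc mS gf.
have mf := measurable_int _ fi.
have mphi := measurable_clip K mf.
have phiK x : (`|clip f K x| <= K)%R by exact: clip_bound (ltW K0).
have phii (m : {measure set T -> \bar R}) (D : set T) :
    m setT < +oo -> measurable D -> m.-integrable D (EFin \o clip f K).
  by move=> moo mD; exact: (bounded_integrable moo mD mphi phiK).
have [a Ea] := integrable_EFinP mS (phii nu S nuoo mS).
have [b Eb] := integrable_EFinP mS (phii mu S muoo mS).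
have [p Ep] :=
  integrable_EFinP mS (integrableS measurableT mS (@subsetT _ _) fi).
have [q Eq] :=
  integrable_EFinP mS (integrableS measurableT mS (@subsetT _ _) gi).
have := tv_dist_integral_le nuoo muoo tv K0 mS mphi phiK.
have phiT := phii mu setT muoo measurableT.
have := le_trans (abse_integral_sub_le mS fi phiT) fc.
move: gf; rewrite /= in Ea Eb *; rewrite Ea Eb Ep Eq.
rewrite -!EFinB -EFinD !abse_EFin !lee_fin !ler_norml.
move=> gf /andP[? ?] /andP[? ?].
lra.
Qed.

(** A function g whose integrals over all sets are, up to c, at least those of
    a function phi bounded by K has small lower tails.  On S = {g <= - L} the
    integral of g is at most - 2 K nu(S), while by domination it is at least
    - K nu(S) - c.  Hence K nu(S) <= c, and the integral of g over S is
    at least - 2 c. *)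
Lemma dominated_tail nu g phi K c L :
  nu setT < +oo -> nu.-integrable setT g -> measurable_fun setT phi ->
  (0 < K)%R -> (forall x, `|phi x| <= K)%R ->
  (forall S, measurable S ->
    \int[nu]_(x in S) (phi x)%:E <= \int[nu]_(x in S) g x + c%:E) ->
  (2 * K <= L)%R ->
  (- (2 * c))%:E <= \int[nu]_(x in [set x | g x <= (- L)%:E]) g x.
Proof.
move=> nuoo gi mphi K0 phiK dom KL; set S := [set x | _].
have mS : measurable S.
  by apply: measurable_le_cst; exact: (measurable_int _ gi).
have [m Em m0] := measure_EFinP nuoo mS.
have giS := integrableS measurableT mS (@subsetT _ _) gi.
have phii := bounded_integrable nuoo mS mphi phiK.
have ci r : nu.-integrable S (cst r%:E) by exact: integrable_cst_fin.
have [q Eq] := integrable_EFinP mS giS.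
have [a Ea] := integrable_EFinP mS phii.
have := dom _ mS.
have : \int[nu]_(x in S) cst (- K)%:E x <= \int[nu]_(x in S) (phi x)%:E.
  apply: le_integral => // x _; rewrite lee_fin.
  by have := phiK x; rewrite ler_norml => /andP[].
have : \int[nu]_(x in S) g x <= \int[nu]_(x in S) cst (- L)%:E x.
  by apply: le_integral => // x; rewrite inE.
rewrite /= in Ea; rewrite !integral_cst// Ea Eq Em -!EFinM -EFinD !lee_fin.
move=> g_le phi_ge phi_le.
have := ler_wpM2r m0 KL; lra.
Qed.

(** On the set where g <= phi - e, integrals of g fall below those of phi by e
    times the measure of the set; domination up to c limits this loss. *)
Lemma dominated_measure_le nu g phi K c e :
  nu setT < +oo -> nu.-integrable setT g -> measurable_fun setT phi ->
  (forall x, `|phi x| <= K)%R ->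
  (forall S, measurable S ->
    \int[nu]_(x in S) (phi x)%:E <= \int[nu]_(x in S) g x + c%:E) ->
  (0 < e)%R ->
  nu [set x | g x <= (phi x - e)%:E] <= (c / e)%:E.
Proof.
move=> nuoo gi mphi phiK dom e0; set S := [set x | _].
have mS : measurable S.
  apply: measurable_le_fun; first exact: (measurable_int _ gi).
  by apply/measurable_EFinP; exact: measurable_funB.
have [m Em m0] := measure_EFinP nuoo mS.
have giS := integrableS measurableT mS (@subsetT _ _) gi.
have phii := bounded_integrable nuoo mS mphi phiK.
have ei : nu.-integrable S (EFin \o cst e) by exact: integrable_cst_fin.
have [q Eq] := integrable_EFinP mS giS.
have [a Ea] := integrable_EFinP mS phii.
have := dom _ mS.
have : \int[nu]_(x in S) g x <= \int[nu]_(x in S) ((phi x)%:E - (cst e x)%:E).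
  apply: le_integral => //; first exact: (integrableB mS phii ei).
  by move=> x; rewrite inE.
rewrite integralB_EFin//= (@integral_cst _ _ _ _ _ _ e%:E)//.
rewrite /= in Ea; rewrite Ea Eq Em -EFinM -EFinB -EFinD !lee_fin => h1 h2.
by rewrite ler_pdivlMr// mulrC; lra.
Qed.

Lemma measurable_below f g e : measurable_fun setT f -> measurable_fun setT g ->
  measurable [set x | g x <= f x - e%:E].
Proof.
by move=> mf mg; apply: measurable_le_fun => //; exact: emeasurable_funB.
Qed.

(** An integrable function is dominated by its own truncations up to
    an arbitrarily small error. *)
Lemma integrable_lower_tail nu g e :
  nu setT < +oo -> nu.-integrable setT g -> (0 < e)%R ->
  \forall L \near +oo%R,
    (- e)%:E <= \int[nu]_(x in [set x | g x <= (- L)%:E]) g x.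
Proof.
move=> nuoo gi e0; have mg := measurable_int _ gi.
have e20 : (0 < e / 2)%R by lra.
have /ge0_cvge0P h := cvg_clip gi.
have [n [n1 nc]] : exists n : nat, (1 <= n%:R :> R)%R /\
    \int[nu]_x `|g x - (clip g n%:R x)%:E| <= (e / 2)%:E.
  near \oo => n; exists n; split; near: n; first exact: nbhs_infty_ger.
  by apply: h e20 => m; exact: integral_ge0.
exists (2 * n%:R)%R; split; first exact: num_real.
move=> L /ltW nL; have -> : e = (2 * (e / 2))%R by field.
have n0 : (0 < n%:R :> R)%R by lra.
have mphi := measurable_clip n%:R mg.
have phin x : (`|clip g n%:R x| <= n%:R)%R by exact: clip_bound (ltW n0).
apply: (dominated_tail nuoo gi mphi n0 phin) nL => S mS.
have phii := bounded_integrable nuoo measurableT mphi phin.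
have := le_trans (abse_integral_sub_le mS gi phii) nc.
have [q Eq] :=
  integrable_EFinP mS (integrableS measurableT mS (@subsetT _ _) gi).
have [a Ea] :=
  integrable_EFinP mS (integrableS measurableT mS (@subsetT _ _) phii).
rewrite /= in Ea *; rewrite Ea Eq -EFinB -EFinD abse_EFin !lee_fin ler_norml.
by move=> /andP[? ?]; lra.
Unshelve. all: by end_near. Qed.

(** The pointwise inequality behind sufficiency.  Write v for the truncated
    value, so that v <= max (f x, - K), and A for the set g <= f - e.
    - If g x > - K, then g x >= v - e outside A, and g x >= v - 2 K always.
    - If g x <= - K, the first summand is g x, and the second one is
      nonpositive: on A since v <= K, and outside A since f x < - K + e,
      hence v < - K + e.
    The constant 2 K absorbs the whole range of the truncation on A. *)
Lemma clip_lower_bound f g K e x : (0 < K)%R -> (0 < e)%R ->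
  (g \_ [set x | (g x <= (- K)%:E)]) x +
    (clip f K x - (e + 2 * K * \1_[set x | g x <= f x - e%:E]%E x))%:E <= g x.
Proof.
move=> K0 e0; set A := [set x | g x <= f x - _]; set B := [set x | _].
have : (`|clip f K x| <= K)%R by exact: clip_bound (ltW K0).
rewrite ler_norml => /andP[cK Kc].
have cf : (clip f K x)%:E <= f x \/ clip f K x = (- K)%R.
  have := clipE f x (ltW K0); case: (leP (- K)%:E (mine K%:E (f x))) => h E.
    by left; rewrite E ge_min lexx orbT.
  by right; case: E.
have below : x \notin A -> f x - e%:E < g x.
  by move=> xA; rewrite ltNge; apply: contra xA => ?; exact: mem_set.
rewrite patchE indicE; case: ifPn => [/set_mem Bx|xB].
  rewrite -[leRHS]adde0 leeD2l// lee_fin.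
  have [xA|/below] := boolP (x \in A); first by rewrite mulr1; lra.
  move=> /lt_le_trans/(_ Bx); rewrite lteBlDr// -EFinD mulr0 => fx.
  by case: cf => [/le_lt_trans/(_ fx)|->]; rewrite ?lte_fin; lra.
have {}xB : (- K)%:E < g x.
  by rewrite ltNge; apply: contra xB => ?; exact: mem_set.
rewrite add0e; have [xA|/below fg] := boolP (x \in A).
  by rewrite mulr1; apply: le_trans (ltW xB); rewrite lee_fin; lra.
rewrite mulr0 addr0; case: cf => [cf|->].
  by apply: le_trans (ltW fg); rewrite EFinB leeD2r.
by apply: le_trans (ltW xB); rewrite lee_fin; lra.
Qed.

(** The pointwise bound is integrated over S.  The summand supported by
    {g <= - K} is nonpositive there, so its integral over S is bounded below
    by its integral over the full tail set, which does not depend on S. *)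
Lemma integral_clip_lower_bound nu f g K e S :
  nu setT < +oo -> measurable_fun setT f -> nu.-integrable setT g ->
  (0 < K)%R -> (0 < e)%R -> measurable S ->
  \int[nu]_(x in [set x | g x <= (- K)%:E]) g x
    + \int[nu]_(x in S) (clip f K x)%:E
    - (e%:E * nu setT + (2 * K)%:E * nu [set x | g x <= f x - e%:E])
  <= \int[nu]_(x in S) g x.
Proof.
move=> nuoo mf gi K0 e0 mS; set B := [set x | g x <= _].
set A := [set x | _ <= f x - _].
have mg := measurable_int _ gi.
have mA : measurable A by exact: measurable_below.
have mB : measurable B by exact: measurable_le_cst.
pose h x := (e + 2 * K * \1_A x)%R.
have mh : measurable_fun setT h.
  by apply: measurable_funD => //; exact: measurable_funM.
have h0 x : (0 <= h x)%R by rewrite /h indicE; case: (_ \in _) => /=; lra.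
have hb x : (`|h x| <= e + 2 * K)%R.
  by rewrite ger0_norm// /h indicE; case: (_ \in _) => /=; lra.
have mphi := measurable_clip K mf.
have phiK x : (`|clip f K x| <= K)%R by exact: clip_bound (ltW K0).
have ih := bounded_integrable nuoo mS mh hb.
have iphi := bounded_integrable nuoo mS mphi phiK.
have igB : nu.-integrable S (g \_ B).
  apply: (integrableS measurableT) => //.
  by apply: (iffLR (integrable_mkcond _ mB)); exact: (integrableS measurableT).
have hT : \int[nu]_(x in S) (h x)%:E <= e%:E * nu setT + (2 * K)%:E * nu A.
  apply: (@le_trans _ _ (\int[nu]_x (h x)%:E)).
    apply: ge0_subset_integral => // [|x _]; last by rewrite lee_fin.
    exact/measurable_EFinP.
  have -> : \int[nu]_x (h x)%:E =
      \int[nu]_x (cst e%:E x + (2 * K)%:E * (\1_A x)%:E).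
    by apply: eq_integral => x _; rewrite /h EFinD EFinM.
  have i1A : nu.-integrable setT (EFin \o \1_A).
    apply: (bounded_integrable (K := 1%R)) => //.
    by move=> x; rewrite indicE; case: (_ \in _); rewrite ?normr0 ?normr1.
  rewrite integralD//; last 2 first.
  - exact: integrable_cst_fin.
  - exact: integrableZl.
  by rewrite integral_cst// integralZl// integral_indic// setIT.
have gB : \int[nu]_(x in B) g x <= \int[nu]_(x in S) (g \_ B) x.
  rewrite -integral_mkcondr.
  have gN x : B x -> 0 <= - g x.
    by move=> Bx; rewrite oppe_ge0; apply: (le_trans Bx); rewrite lee_fin; lra.
  have opp D : measurable D ->
      \int[nu]_(x in D) - g x = - \int[nu]_(x in D) g x.
    move=> mD; apply: integralN; apply: integrable_add_def => //.
    exact: (integrableS measurableT mD (@subsetT _ _) gi).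
  have mSB : measurable (S `&` B) by exact: measurableI.
  rewrite -leeN2 -(opp B)// -(opp (S `&` B))//.
  apply: ge0_subset_integral => //.
  by apply: measurableT_comp => //; exact: measurable_funS mg.
have phih := integrableB mS iphi ih.
apply: (@le_trans _ _ (\int[nu]_(x in S)
    ((g \_ B) x + ((clip f K x)%:E - (h x)%:E)))).
  rewrite integralD//.
  by rewrite integralB_EFin// addeA leeB// leeD2r.
apply: le_integral => //; first exact: integrableD.
  exact: (integrableS measurableT).
by move=> x _; exact: clip_lower_bound.
Qed.

(** Borel-Cantelli: along a subsequence the sets where
    f_ (phi k) <= f - 1 / k.+1 have summable measures, so almost every point
    lies in finitely many of them. *)
Lemma subseq_le_limn_einf mu f (f_ : nat -> T -> \bar R) :
  measurable_fun setT f -> (forall n, measurable_fun setT (f_ n)) ->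
  (forall e, (0 < e)%R ->
    (fun n => mu [set x | f_ n x <= f x - e%:E]) @ \oo --> 0) ->
  exists2 phi : nat -> nat, increasing_seq phi &
    {ae mu, forall x, f x <= limn_einf (fun k => f_ (phi k) x)}.
Proof.
move=> mf mf_ h.
have /choice[s sP] : forall p : nat * nat, exists n, (p.2 < n)%N /\
    mu [set x | f_ n x <= f x - (p.1.+1%:R^-1)%:E] <= (1 / (2 ^ p.1.+1)%:R)%:E.
  move=> [k N] /=.
  near \oo => n; exists n; split; near: n; first exact: nbhs_infty_gt.
  have := h (k.+1%:R^-1)%R; rewrite invr_gt0 ltr0n => /(_ isT).
  by move=> /ge0_cvge0P; apply.
(* The second argument of s makes phi increasing, the first one is the
   index of the tolerance and of the measure bound. *)
pose phi := fix phi k := if k is k'.+1 then s (k, phi k') else s (0%N, 0%N).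
exists phi.
  by apply/increasing_seqP => k; rewrite ltEnat /=; exact: (sP (k.+1, phi k)).1.
pose F k := [set x | f_ (phi k) x <= f x - (k.+1%:R^-1)%:E].
have mF k : measurable (F k) by exact: measurable_below.
exists (lim_sup_set F); split.
- by apply: bigcap_measurable => // n _; apply: bigcup_measurable => k _.
- apply: lim_sup_set_cvg0 => //.
  apply: (@le_lt_trans _ _ 1); last exact: ltry.
  apply: le_trans (epsilon_trick0 xpredT ler01).
  apply: lee_nneseries => // k _.
  by case: k => [|k]; [exact: (sP (0, 0)%N).2|exact: (sP (k.+1, phi k)).2].
move=> x /= hx; apply: contrapT => Fx; apply: hx.
have [n nF] : exists n, forall j, (n <= j)%N -> ~ F j x.
  apply: contrapT => /forallNP nF; apply: Fx => n _.
  by have /existsNP[j /not_implyP[nj /contrapT Fj]] := nF n; exists j.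
apply/lee_subgt0Pr => e e0; apply: limf_einf_ge; near=> k.
have {}nF : ~ F k x by apply: nF; near: k; exact: nbhs_infty_ge.
apply: ltW; apply: (@le_lt_trans _ _ (f x - (k.+1%:R^-1)%:E)).
  rewrite leeD2l// leeN2 lee_fin; apply: ltW.
  by near: k; exact: (near_infty_natSinv_lt (PosNum e0)).
by move: nF => /negP; rewrite -ltNge.
Unshelve. all: by end_near. Qed.

End integrals.

(** * Measures converging in total variation *)

Section convergence.
Context (R : realType) (d : measure_display) (T : measurableType d)
  (mu_ : nat -> {finite_measure set T -> \bar R})
  (mu : {measure set T -> \bar R}) (f_ : nat -> T -> \bar R) (f : T -> \bar R).
Context (mu_cvg : cvg_in_tv mu_ mu) (f_int : mu.-integrable setT f)
  (fn_int : forall n, (mu_ n).-integrable setT (f_ n)).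

Local Notation below e n := [set x | f_ n x <= f x - e%:E].
Local Notation tail K n :=
  (\int[mu_ n]_(x in [set x | f_ n x <= (- K)%:E]) f_ n x).
Local Notation gap A n :=
  (\int[mu_ n]_(x in A) f_ n x - \int[mu]_(x in A) f x).

Let mf : measurable_fun setT f := measurable_int _ f_int.

Let mf_ n : measurable_fun setT (f_ n) := measurable_int _ (fn_int n).

Lemma measurable_belown e n : measurable (below e n).
Proof. exact: measurable_below. Qed.

Lemma mu_n_lty n : mu_ n setT < +oo.
Proof. by rewrite ltey_eq fin_num_measure. Qed.

(** Testing with the constant 0 shows that the distance is nonnegative, which
    is what makes its convergence to 0 an upper bound. *)
Lemma tv_near (e : R) : (0 < e)%R ->
  \forall n \near \oo, tv_dist (mu_ n) mu <= e%:E.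
Proof.
move=> e0; move: mu_cvg => /ge0_cvge0P; apply => // n.
apply: (@le_trans _ _
  `|\int[mu_ n]_x (cst 0%R x)%:E - \int[mu]_x (cst 0%R x)%:E|) => //.
apply: ereal_sup_ubound; exists (cst 0%R) => //.
by split=> // x /=; apply/andP; split; lra.
Qed.

Lemma mu_lty : mu setT < +oo.
Proof.
have [n tvn] := filter_ex (tv_near ltr01).
exact: (tv_dist_fin (mu_n_lty n) tvn).
Qed.

Lemma clip_near c : (0 < c)%R ->
  \forall n \near \oo, \int[mu]_x `|f x - (clip f n%:R x)%:E| <= c%:E.
Proof.
move=> c0; have /ge0_cvge0P := cvg_clip f_int; apply => // n.
exact: integral_ge0.
Qed.

(** The form in which the gap condition is used for necessity: up to 3 c, all
    f_ n with n large dominate one and the same bounded function, which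
    is L1 close to f. *)
Lemma clip_dominated c : (0 < c)%R ->
  (forall e : R, (0 < e)%R ->
    \forall n \near \oo, forall A, measurable A -> (- e)%:E <= gap A n) ->
  exists2 K : R, (1 <= K)%R & \int[mu]_x `|f x - (clip f K x)%:E| <= c%:E /\
    \forall n \near \oo, forall S, measurable S ->
      \int[mu_ n]_(x in S) (clip f K x)%:E <=
        \int[mu_ n]_(x in S) f_ n x + (3 * c)%:E.
Proof.
move=> c0 gap0.
have [k [k1 kc]] : exists k : nat, (1 <= k%:R :> R)%R /\
    \int[mu]_x `|f x - (clip f k%:R x)%:E| <= c%:E.
  near \oo => k; exists k; split; near: k; first exact: nbhs_infty_ger.
  exact: clip_near.
exists k%:R => //; split => //; have k0 : (0 < k%:R :> R)%R by lra.
near=> n => S mS.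
apply: (@integral_clip_le_near _ _ _ _ _ _ _ _ _ (c / k%:R) S
  mu_lty (mu_n_lty n) _ k0 _ f_int (fn_int n) kc mS).
- by near: n; apply: tv_near; exact: divr_gt0.
- by rewrite mulrC divfK// gt_eqF.
- by move: S mS; near: n; exact: gap0.
Unshelve. all: by end_near. Qed.

(** Where f_ n <= f - e, either f differs from its truncation by e / 2, which
    is rare by Markov's inequality, or f_ n is below the truncation by e / 2,
    which is rare because f_ n dominates the truncation. *)
Lemma cvg_below_of_gap :
  (forall e : R, (0 < e)%R ->
    \forall n \near \oo, forall A, measurable A -> (- e)%:E <= gap A n) ->
  forall e : R, (0 < e)%R -> (fun n => mu (below e n)) @ \oo --> 0.
Proof.
move=> gap0 e e0; apply/ge0_cvge0P => // t t0.
(* The three contributions are 2 c / e <= t / 12 (Markov), 6 c / e <= t / 4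
   (domination) and c <= t / 3 (change of measure). *)
pose c := (Num.min (t / 3) (t * e / 24))%R.
have c0 : (0 < c)%R by rewrite lt_min !divr_gt0// mulr_gt0.
have ct : (c <= t / 3)%R by rewrite ge_min lexx.
have cte : (c <= t * e / 24)%R by rewrite ge_min lexx orbT.
have e20 : (0 < e / 2)%R by lra.
have [K K1 [fK dom]] := clip_dominated c0 gap0.
have mphi := measurable_clip K mf.
have phiK x : (`|clip f K x| <= K)%R by apply: clip_bound; lra.
have iphi := bounded_integrable mu_lty measurableT mphi phiK.
pose far := [set x | (e / 2)%:E <= `|f x - (clip f K x)%:E|].
have mfphi := measurable_int _ (integrableB measurableT f_int iphi).
have mfar : measurable far.
  rewrite -[far]setTI; apply: emeasurable_fun_c_infty => //.
  exact: measurableT_comp.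
have mufar : (e / 2)%:E * mu far <= c%:E.
  apply: le_trans fK.
  have := @le_integral_abse _ _ _ mu setT measurableT _ (e / 2)%R mfphi e20.
  by rewrite setTI.
near=> n.
pose low := [set x | f_ n x <= (clip f K x - e / 2)%:E].
have mlow : measurable low.
  apply: measurable_le_fun => //.
  by apply/measurable_EFinP; exact: measurable_funB.
have sub : below e n `<=` far `|` low.
  move=> x; rewrite /far /low /= => fn.
  have [|fx] := leP (e / 2)%:E `|f x - (clip f K x)%:E|; first by left.
  right; apply: (le_trans fn); move: fx.
  case: (f x) => [r||]//=.
  by rewrite lte_fin lee_fin ltr_norml => /andP[? ?]; lra.
have mulow : (mu_ n : {measure set T -> \bar R}) low <= (3 * c / (e / 2))%:E.
  apply: (dominated_measure_le (mu_n_lty n) (fn_int n) mphi phiK) => //.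
  by near: n.
have tvn : tv_dist (mu_ n) mu <= c%:E by near: n; exact: tv_near.
have [_ lowtv] := tv_dist_measure_le (mu_n_lty n) mu_lty tvn mlow.
apply: (@le_trans _ _ (mu far + mu low)).
  apply: le_trans (measureU2 mu mfar mlow).
  apply: le_measure => //; rewrite inE; first exact: measurable_belown.
  exact: measurableU.
move: mufar mulow lowtv.
have [a -> _] := measure_EFinP mu_lty mfar.
have [b -> _] := measure_EFinP (mu_n_lty n) mlow.
have [b' -> _] := measure_EFinP mu_lty mlow.
rewrite -EFinM -!EFinD !lee_fin => ae be b'b.
have ? : (a <= t / 12)%R by rewrite -(ler_pM2l e20); lra.
have ? : (b <= t / 4)%R.
  by apply: (le_trans be); rewrite ler_pdivrMr//; lra.
lra.
Unshelve. all: by end_near. Qed.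

(** One threshold 2 K serves all large n by domination; the finitely many
    remaining f_ n are treated one at a time. *)
Lemma tail_of_gap :
  (forall e : R, (0 < e)%R ->
    \forall n \near \oo, forall A, measurable A -> (- e)%:E <= gap A n) ->
  forall e : R, (0 < e)%R ->
    \forall K \near +oo%R, forall n, (- e)%:E <= tail K n.
Proof.
move=> gap0 e e0; have c0 : (0 < e / 6)%R by lra.
have [K K1 [_ [N _ dom]]] := clip_dominated c0 gap0.
have K0 : (0 < K)%R by lra.
have phiK x : (`|clip f K x| <= K)%R by exact: clip_bound (ltW K0).
near=> L => n; have [nN|Nn] := ltnP n N.
  move: n nN; near: L; apply: near_forall_ltn => n.
  exact: (integrable_lower_tail (mu_n_lty n) (fn_int n) e0).
have -> : e = (2 * (3 * (e / 6)))%R by field.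
apply: (dominated_tail (mu_n_lty n) (fn_int n) (measurable_clip K mf) K0 phiK).
  exact: dom.
by near: L; exact: nbhs_pinfty_ge (num_real _).
Unshelve. all: by end_near. Qed.

(** With K large enough for the uniform tail bound and for the truncation
    of f, fixed before n, the right-hand side of the integrated pointwise bound
    differs from the integral of f under mu by small terms that do
    not depend on the set of integration. *)
Lemma gap_of_below_tail :
  (forall e : R, (0 < e)%R -> (fun n => mu (below e n)) @ \oo --> 0) ->
  (forall e : R, (0 < e)%R ->
    \forall K \near +oo%R, forall n, (- e)%:E <= tail K n) ->
  forall e : R, (0 < e)%R ->
    \forall n \near \oo, forall A, measurable A -> (- e)%:E <= gap A n.
Proof.
move=> cvg_below tail0 e e0; have c0 : (0 < e / 6)%R by lra.
(* Errors of at most c each: the tail of f_ n, the truncation of f, the change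
   of measure for the truncation, and eps times the total mass; the set where
   f_ n <= f - eps accounts for 2 c. *)
set c := (e / 6)%R in c0.
have [M [_ tailM]] := tail0 c c0.
have [k [k1 Mk kc]] : exists k : nat, [/\ (1 <= k%:R :> R)%R, (M < k%:R)%R &
    \int[mu]_x `|f x - (clip f k%:R x)%:E| <= c%:E].
  near \oo => k; exists k; split; near: k.
  - exact: nbhs_infty_ger.
  - exact: nbhs_infty_gtr.
  - exact: clip_near.
set K : R := k%:R in k1 Mk kc; have K0 : (0 < K)%R by lra.
have {}tailK := tailM _ Mk.
have mphi := measurable_clip K mf.
have phiK x : (`|clip f K x| <= K)%R by exact: clip_bound (ltW K0).
have iphi := bounded_integrable mu_lty measurableT mphi phiK.
have [m Em m0] := measure_EFinP mu_lty measurableT.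
have m10 : (0 < m + 1)%R by lra.
(* m + 1 bounds the total mass of mu_ n once the distance to mu is below 1. *)
pose eps := (c / (m + 1))%R; have eps0 : (0 < eps)%R by exact: divr_gt0.
pose s := (Num.min 1 (c / (2 * K)))%R.
have s0 : (0 < s)%R by rewrite lt_min ltr01 divr_gt0// mulr_gt0.
have s1 : (s <= 1)%R by rewrite ge_min lexx.
have K20 : (0 < 2 * K)%R by lra.
have sK : (2 * K * s <= c)%R.
  by rewrite mulrC -ler_pdivlMr// ge_min lexx orbT.
near=> n => S mS.
have tvn : tv_dist (mu_ n) mu <= s%:E by near: n; exact: tv_near.
have muA : mu (below eps n) <= s%:E.
  by near: n; have /ge0_cvge0P := cvg_below _ eps0; apply.
have [+ _] :=
  tv_dist_measure_le (mu_n_lty n) mu_lty tvn (measurable_belown eps n).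
have [+ _] := tv_dist_measure_le (mu_n_lty n) mu_lty tvn measurableT.
have := integral_clip_lower_bound (mu_n_lty n) mf (fn_int n) K0 eps0 mS.
have := tv_dist_integral_le (mu_n_lty n) mu_lty tvn K0 mS mphi phiK.
have := le_trans (abse_integral_sub_le mS f_int iphi) kc.
have := tailK n.
have mB : measurable [set x | f_ n x <= (- K)%:E] by exact: measurable_le_cst.
have TS := @subsetT _ S; have TB := @subsetT _ [set x | f_ n x <= (- K)%:E].
have [t ->] := integrable_EFinP mB (integrableS measurableT mB TB (fn_int n)).
have [q ->] := integrable_EFinP mS (integrableS measurableT mS TS (fn_int n)).
have [p ->] := integrable_EFinP mS (integrableS measurableT mS TS f_int).
have [b Eb] := integrable_EFinP mS (integrableS measurableT mS TS iphi).
have [a Ea] :=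
  integrable_EFinP mS (bounded_integrable (mu_n_lty n) mS mphi phiK).
rewrite /= in Ea Eb *; rewrite Ea Eb.
move: muA; rewrite Em.
have [mA -> mA0] := measure_EFinP mu_lty (measurable_belown eps n).
have [mA' -> _] := measure_EFinP (mu_n_lty n) (measurable_belown eps n).
have [m' -> _] := measure_EFinP (mu_n_lty n) measurableT.
rewrite -!EFinM -!EFinB -!EFinD !abse_EFin !lee_fin !ler_norml.
move=> mAs tc /andP[? ?] /andP[? ?] low m'm mA'm.
have epsm : (eps * m' <= c)%R.
  apply: (@le_trans _ _ (eps * (m + 1))%R); first by rewrite ler_pM2l//; lra.
  by rewrite /eps divfK// gt_eqF.
have KmA : (2 * K * mA' <= 2 * c)%R.
  apply: (@le_trans _ _ (2 * K * (2 * s))%R); first by rewrite ler_pM2l//; lra.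
  by rewrite mulrCA ler_pM2l.
have : (e = 6 * c)%R by rewrite /c; field.
lra.
Unshelve. all: by end_near. Qed.

End convergence.

Theorem theorem1p1 (R : realType) (d : measure_display) (T : measurableType d)
    (mu_ : nat -> {finite_measure set T -> \bar R})
    (mu : {measure set T -> \bar R})
    (f_ : nat -> T -> \bar R) (f : T -> \bar R)
    (mu_cvg : cvg_in_tv mu_ mu)
    (f_int : mu.-integrable setT f)
    (fn_int : forall n, (mu_ n).-integrable setT (f_ n)) :
  let cvg_below := forall eps : R, (0 < eps)%R ->
    (fun n => mu [set x | f_ n x <= f x - eps%:E]) @ \oo --> 0 in
  let subseq_ge := exists2 phi : nat -> nat, increasing_seq phi &
    {ae mu, forall x, f x <= limn_einf (fun k => f_ (phi k) x)} in
  (0 <= limn_einf (fun n =>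
     ereal_inf [set \int[mu_ n]_(x in A) f_ n x - \int[mu]_(x in A) f x |
                A in [set A : set T | measurable A]])
   <->
   (cvg_below /\ subseq_ge) /\
   0 <= limf_einf (fun K : R =>
     ereal_inf [set \int[mu_ n]_(x in [set x | f_ n x <= (- K)%:E]) f_ n x |
                n in [set: nat]]) +oo%R)
  /\ (cvg_below -> subseq_ge).
Proof.
move=> cvg_below subseq_ge.
have subseq : cvg_below -> subseq_ge.
  apply: subseq_le_limn_einf => [|n]; first exact: (measurable_int _ f_int).
  exact: (measurable_int _ (fn_int n)).
split=> //; rewrite (limf_einf_inf_ge0P (F := \oo)) limf_einf_inf_ge0P.
split=> [gap0|[[below0 _] tail0]].
  have below0 : cvg_below := cvg_below_of_gap mu_cvg f_int fn_int gap0.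
  split; first by split=> //; exact: subseq.
  move=> e e0; have := tail_of_gap mu_cvg f_int fn_int gap0 e0.
  by apply: filterS => K tailK n _; exact: tailK.
apply: (gap_of_below_tail mu_cvg f_int fn_int below0) => e /tail0.
by apply: filterS => K tailK n; exact: tailK.
Qed.
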